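(* Let $\mathcal{R}$ be a pro-solvable Lie algebra. Then $\mathcal{R}^{[2]}=[\mathcal{R},\mathcal{R}]$ is a pro-nilpotent Lie algebra.
   Context: All Lie algebras and vector spaces are over $\mathbb{C}$ and have a countable Hamel basis. For a Lie algebra $\mathcal{L}$ put $\mathcal{L}^1=\mathcal{L}^{[1]}=\mathcal{L}$, $\mathcal{L}^{k+1}=[\mathcal{L}^k,\mathcal{L}]$, $\mathcal{L}^{[k+1]}=[\mathcal{L}^{[k]},\mathcal{L}^{[k]}]$. An infinite-dimensional Lie algebra $\mathcal{L}$ is pro-nilpotent if $\bigcap_{i\ge1}\mathcal{L}^i=0$ and $\dim(\mathcal{L}/\mathcal{L}^{i+1})<\infty$ for all $i\ge1$; it is pro-solvable if $\bigcap_{i\ge1}\mathcal{L}^{[i]}=0$ and $\dim(\mathcal{L}/\mathcal{L}^{[i+1]})<\infty$ for all $i\ge1$. *)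

(* Defs.v *)
From HB Require Import structures.
From mathcomp Require Import all_boot all_order all_algebra.
From mathcomp Require Import boolp classical_sets cardinality reals.
From mathcomp Require Import complex.

Set Implicit Arguments.
Unset Strict Implicit.
Unset Printing Implicit Defensive.

Import GRing.Theory.
Local Open Scope ring_scope.

Section LinearAlgebra.
Variables (K : fieldType) (V : lmodType K).
Implicit Types (A B : set V).

Definition span A : {pred V} := fun x =>
  `[< exists r : seq (K * V),
        (forall p, p \in r -> A p.2) /\ x = \sum_(p <- r) p.1 *: p.2 >].

Lemma spanP A x :
  reflect (exists r : seq (K * V),
             (forall p, p \in r -> A p.2) /\ x = \sum_(p <- r) p.1 *: p.2)
          (x \in span A).
Proof. exact: asboolP. Qed.

Definition lin_indep B : Prop :=
  forall (s : seq V) (c : V -> K), uniq s -> (forall y, y \in s -> B y) ->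
    \sum_(y <- s) c y *: y = 0 -> forall y, y \in s -> c y = 0.

Definition hamel_basis B : Prop :=
  lin_indep B /\ forall x, x \in span B.

End LinearAlgebra.

Section SpanClosed.
Variables (K : fieldType) (V : lmodType K) (A : set V).

Lemma span_sub x : A x -> x \in span A.
Proof.
move=> Ax; apply/spanP; exists [:: (1, x)]; split.
  by move=> p; rewrite inE => /eqP ->.
by rewrite big_seq1 scale1r.
Qed.

Lemma span_submod_closed : submod_closed (span A).
Proof.
split=> [|a x y].
  by apply/spanP; exists [::]; rewrite big_nil.
move=> /spanP[r [rA ->]] /spanP[t [tA ->]]; apply/spanP.
exists ([seq (a * p.1, p.2) | p <- r] ++ t); split=> [p|].
  by rewrite mem_cat => /orP[/mapP[q /rA Aq ->]|/tA].
rewrite big_cat big_map scaler_sumr /=; congr (_ + _).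
by apply: eq_bigr => p _; rewrite scalerA.
Qed.

HB.instance Definition _ :=
  GRing.isSubmodClosed.Build K V (span A) span_submod_closed.

End SpanClosed.

Definition finite_dim (K : fieldType) (V : lmodType K) : Prop :=
  exists2 B : set V, hamel_basis B & finite_set B.

Definition countable_dim (K : fieldType) (V : lmodType K) : Prop :=
  exists2 B : set V, hamel_basis B & countable B.

Section Quotient.
Local Open Scope quotient_scope.
Variables (K : fieldType) (V : lmodType K) (S : submodClosed V).

(* Over a semiring a submodClosed predicate need not be closed under opposite, *)
(* so it carries no zmodClosed structure; over a field it is restored here in  *)
(* order to reuse the additive quotient group of ring_quotient.                *)
Definition zmod_of_submod : {pred V} := S.

Lemma zmod_of_submod_closed : zmod_closed zmod_of_submod.
Proof. exact/GRing.submod_closedB/submodClosedP. Qed.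

HB.instance Definition _ :=
  GRing.isZmodClosed.Build V zmod_of_submod zmod_of_submod_closed.

Definition lmod_quot : Type := Quotient.quot zmod_of_submod.
HB.instance Definition _ := GRing.Zmodule.on lmod_quot.
HB.instance Definition _ := EqQuotient.on lmod_quot.

Definition quot_scale (a : K) (x : lmod_quot) : lmod_quot :=
  \pi_lmod_quot (a *: repr x).

Lemma pi_quot_eq (x y : V) :
  (\pi_lmod_quot x == \pi_lmod_quot y) = (x - y \in S).
Proof. by rewrite piE. Qed.

Lemma pi_quot_add (x y : V) :
  \pi_lmod_quot (x + y) = \pi_lmod_quot x + \pi_lmod_quot y.
Proof. by rewrite [RHS]piE. Qed.

Lemma pi_quot_scale (a : K) (x : V) :
  \pi_lmod_quot (a *: x) = quot_scale a (\pi_lmod_quot x).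
Proof.
apply/eqP; rewrite pi_quot_eq -scalerBr; apply: rpredZ.
by rewrite -pi_quot_eq reprK.
Qed.

Lemma quot_scaleA a b x :
  quot_scale a (quot_scale b x) = quot_scale (a * b) x.
Proof. by rewrite -[x]reprK -!pi_quot_scale scalerA reprK. Qed.

Lemma quot_scale1 : left_id 1 quot_scale.
Proof. by move=> x; rewrite -[x]reprK -pi_quot_scale scale1r. Qed.

Lemma quot_scaleDr : right_distributive quot_scale +%R.
Proof.
move=> a x y; rewrite -[x]reprK -[y]reprK -pi_quot_add -!pi_quot_scale.
by rewrite scalerDr pi_quot_add.
Qed.

Lemma quot_scaleDl x : {morph quot_scale^~ x : a b / a + b}.
Proof.
by move=> a b; rewrite -[x]reprK -!pi_quot_scale scalerDl pi_quot_add.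
Qed.

HB.instance Definition _ := GRing.Zmodule_isLmodule.Build K lmod_quot
  quot_scaleA quot_scale1 quot_scaleDr quot_scaleDl.

End Quotient.

HB.mixin Record Lmodule_isLieAlgebra (K : fieldType) L of GRing.Lmodule K L := {
  lie : L -> L -> L;
  lie_linearl : forall y : L, linear (lie^~ y);
  lie_linearr : forall x : L, linear (lie x);
  lie_alt : forall x : L, lie x x = 0;
  lie_jacobi : forall x y z : L,
    lie x (lie y z) + lie y (lie z x) + lie z (lie x y) = 0
}.

#[short(type="lieAlgType")]
HB.structure Definition LieAlgebra (K : fieldType) :=
  {L of GRing.Lmodule K L & Lmodule_isLieAlgebra K L}.

HB.mixin Record isLieClosed (K : fieldType) (L : lieAlgType K)
    (S : {pred L}) := {
  lie_closed : {in S &, forall x y : L, lie x y \in S}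
}.

#[short(type="lieSubalgClosed")]
HB.structure Definition LieSubalgClosed (K : fieldType) (L : lieAlgType K) :=
  {S of @GRing.SubmodClosed K L S & isLieClosed K L S}.

Section SubLieAlgebra.
Variables (K : fieldType) (L : lieAlgType K) (S : lieSubalgClosed L).

Record sub_lie : predArgType :=
  SubLie { sub_lie_val : L; sub_lie_valP : sub_lie_val \in S }.

HB.instance Definition _ := [isSub for sub_lie_val].
HB.instance Definition _ := [Choice of sub_lie by <:].
HB.instance Definition _ := [SubChoice_isSubLmodule of sub_lie by <:].

Definition sub_bracket (x y : sub_lie) : sub_lie :=
  SubLie (lie_closed _ _ (sub_lie_valP x) (sub_lie_valP y)).

Lemma sub_bracket_linearl y : linear (sub_bracket^~ y).
Proof. by move=> a x z; apply: val_inj => /=; rewrite lie_linearl. Qed.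

Lemma sub_bracket_linearr x : linear (sub_bracket x).
Proof. by move=> a y z; apply: val_inj => /=; rewrite lie_linearr. Qed.

Lemma sub_bracket_alt x : sub_bracket x x = 0.
Proof. by apply: val_inj; apply: lie_alt. Qed.

Lemma sub_bracket_jacobi x y z :
  sub_bracket x (sub_bracket y z) + sub_bracket y (sub_bracket z x)
    + sub_bracket z (sub_bracket x y) = 0.
Proof. by apply: val_inj; apply: lie_jacobi. Qed.

HB.instance Definition _ := Lmodule_isLieAlgebra.Build K sub_lie
  sub_bracket_linearl sub_bracket_linearr sub_bracket_alt sub_bracket_jacobi.

End SubLieAlgebra.

Section Series.
Variables (K : fieldType) (L : lieAlgType K).

Definition lie_prod (A B : {pred L}) : {pred L} :=
  span [set z : L | exists x y, [/\ x \in A, y \in B & z = lie x y]].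

(* Indices start at 1; the value at index 0 is also L and is never used.       *)
Definition lower_central (i : nat) : {pred L} :=
  iter i.-1 (fun A => lie_prod A predT) predT.

Definition derived_series (i : nat) : {pred L} :=
  iter i.-1 (fun A => lie_prod A A) predT.

Lemma lower_central_submod i : submod_closed (lower_central i).
Proof. by rewrite /lower_central; case: i.-1 => [//|n]; apply: span_submod_closed. Qed.

HB.instance Definition _ i :=
  GRing.isSubmodClosed.Build K L (lower_central i) (lower_central_submod i).

Lemma derived_series_submod i : submod_closed (derived_series i).
Proof. by rewrite /derived_series; case: i.-1 => [//|n]; apply: span_submod_closed. Qed.

HB.instance Definition _ i :=
  GRing.isSubmodClosed.Build K L (derived_series i) (derived_series_submod i).

Lemma lie_prodS (A B : {pred L}) :
  {subset A <= B} -> {subset lie_prod A A <= lie_prod B B}.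
Proof.
move=> AB z /spanP[r [rA ->]]; apply/spanP; exists r; split=> // p /rA.
by move=> [x [y [xA yA ->]]]; exists x, y; split=> //; apply: AB.
Qed.

Lemma derived_series_lie i :
  {in derived_series i &, forall x y : L, lie x y \in derived_series i}.
Proof.
pose D n : {pred L} := iter n (fun A => lie_prod A A) predT.
have DS n : {subset D n.+1 <= D n}.
  by elim: n => [//|n IH]; apply: lie_prodS.
move=> x y xD yD; apply: (DS i.-1); apply: span_sub.
by exists x, y.
Qed.

HB.instance Definition _ i :=
  isLieClosed.Build K L (derived_series i) (@derived_series_lie i).

End Series.

Arguments lower_central {K} L i.
Arguments derived_series {K} L i.

Definition pro_nilpotent (K : fieldType) (L : lieAlgType K) : Prop :=
  [/\ ~ finite_dim L,
      forall x : L, (forall i, (1 <= i)%N -> x \in lower_central L i) -> x = 0 &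
      forall i, (1 <= i)%N -> finite_dim (lmod_quot (lower_central L i.+1))].

Definition pro_solvable (K : fieldType) (L : lieAlgType K) : Prop :=
  [/\ ~ finite_dim L,
      forall x : L, (forall i, (1 <= i)%N -> x \in derived_series L i) -> x = 0 &
      forall i, (1 <= i)%N -> finite_dim (lmod_quot (derived_series L i.+1))].

(* Main.v *)
From HB Require Import structures.
Require Import Defs.
From mathcomp Require Import all_boot all_order all_algebra.
From mathcomp Require Import reals complex.
From mathcomp Require Import boolp classical_sets cardinality.
From mathcomp Require Import zify.

Set Implicit Arguments.
Unset Strict Implicit.
Unset Printing Implicit Defensive.

Import GRing.Theory.
Local Open Scope ring_scope.

(** Write D_k for the derived series of L and N^i for the lower central series
    of N = D_2 = [L, L].  Two comparisons between these filtrations of N carry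
    the theorem: each contains the terms of the other far enough out.

    One is formal: [D_k, D_k] lies in [D_k, N] for k >= 2, so by induction
    D_(j+2) lies in N^(j+1) ([derived_lower_central]).  Hence N^(i+1) has finite
    codimension, since some D_k inside it does.

    The other says that some N^(i+1) lies in a given D_k
    ([lower_central_derived]); it makes the intersection of the N^i vanish.
    The quotient L / D_k is a finite-dimensional solvable Lie algebra, so this is
    the classical fact that the derived algebra of such an algebra is nilpotent.
    It is proved for an arbitrary finite-dimensional representation rho of L that
    kills some D_k, and then applied to the adjoint representation on L / D_k:
    the claim is that long enough products of operators rho x with x in [L, L]
    vanish ([solvable_nilpotent_action]).

    Nilpotency of the action passes from a subrepresentation and its quotient to
    the whole, so by induction on the dimension rho may be taken irreducible, and
    then [L, L] acts as 0.  This last point rests on a lemma of Jacobson: in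
    characteristic 0, a commutator c = [x, a] of matrices that commutes with a is
    nilpotent ([commutator_nilpotent]).  Let A be the last term of the derived
    series that acts nontrivially, and suppose that it lies in [L, L].  The
    operators of A commute, so the brackets [x, a] with a in A act by commuting
    nilpotent operators; their common kernel is nonzero and invariant, hence
    everything, and A acts centrally.  But A is spanned by brackets, which are
    therefore nilpotent by the same lemma, and central; their kernels are again
    nonzero and invariant, so A acts as 0, a contradiction.

    That N is infinite-dimensional, as well as every statement on Hamel bases, is
    obtained by trading bases for injective linear maps into polynomials or row
    vectors ([countable_dimP], [finite_dimP], [finite_codimP]). *)

(** * Row spaces and commuting nilpotent matrices *)

Lemma ex_least (Q : nat -> Prop) :
  (exists m, Q m) -> exists2 m, Q m & forall k, Q k -> (m <= k)%N.
Proof.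
move=> exQ; have exb : exists m, `[< Q m >] by case: exQ => m /asboolP; exists m.
case: (ex_minnP exb) => m /asboolP Qm minm.
by exists m => // k /asboolP; apply: minm.
Qed.

Section RowSpaces.
Variables (K : fieldType) (n : nat).

(** A matrix of maximal rank with rows in [P] works: a vector of [P] outside its
    row space could be adjoined to it. *)
Lemma submodule_row_space (P : {pred 'rV[K]_n}) : submod_closed P ->
  exists U : 'M_n, forall v : 'rV_n, (v <= U)%MS = (v \in P).
Proof.
case=> P0 Plin.
pose inP m (U : 'M_(m, n)) := forall v : 'rV_n, (v <= U)%MS -> v \in P.
(* Maximising the rank is phrased as minimising the corank. *)
have [|k [U UP kE] kmin] :=
    @ex_least (fun k => exists2 U : 'M_n, inP _ U & k = n - \rank U)%N.
  exists (n - 0)%N, 0; last by rewrite mxrank0.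
  by move=> v; rewrite submx0 => /eqP ->.
exists U => v; apply/idP/idP => [/UP //|Pv].
have UvP : inP _ (U + v)%MS.
  move=> w /sub_addsmxP[[a b] /= ->]; rewrite (mx11_scalar b) mul_scalar_mx addrC.
  by apply: Plin => //; apply/UP/submxMl.
have Uv_le : (\rank (U + v)%MS <= \rank U)%N.
  have := kmin _ (ex_intro2 _ _ _ UvP erefl); rewrite kE.
  by have := rank_leq_row U; have := rank_leq_row (U + v)%MS; lia.
have := mxrank_leqif_sup (addsmxSl U v); case=> Ule.
have -> : \rank U == \rank (U + v)%MS by rewrite eqn_leq Ule Uv_le.
move=> /esym; apply: submx_trans; exact: addsmxSr.
Qed.

(** Among the nonzero subspaces stable under [G], one of least dimension is
    killed by every [g] in [G]: its intersection with the kernel of [g] is stable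
    because [G] commutes, and nonzero because [g] is nilpotent. *)
Lemma commuting_nilpotent_kernel (G : 'M[K]_n.+1 -> Prop) :
    (forall g h, G g -> G h -> g * h = h * g) ->
    (forall g, G g -> exists k, g ^+ k = 0) ->
  exists2 U : 'M_n.+1, U != 0 & forall g, G g -> U *m g = 0.
Proof.
move=> Gcomm Gnil.
pose good (U : 'M_n.+1) := U != 0 /\ forall g, G g -> stablemx U g.
have [|r [U [U0 Ust] rE] rmin] :=
    @ex_least (fun r => exists2 U, good U & r = \rank U).
  exists (\rank (1%:M : 'M[K]_n.+1)), 1%:M => //; split; rewrite ?oner_eq0 // => g _.
    exact: submx1.
exists U => // g Gg; have [k gk] := Gnil g Gg.
apply/sub_kermxP.
(* The last nonzero power U g^j lies both in U and in the kernel of g. *)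
have cap0 : (U :&: kermx g)%MS != 0.
  have [|j Ugj jmin] := @ex_least (fun j => U *m (g ^+ j) = 0).
    by exists k; rewrite gk mulmx0.
  case: j => [|j] in Ugj jmin.
    by case/eqP: U0; rewrite -[U]mulmx1.
  have : U *m (g ^+ j) != 0.
    by apply/eqP => /jmin; rewrite ltnn.
  apply: contraNneq => cap0; rewrite -submx0 -cap0 sub_capmx; apply/andP; split.
    elim: j {Ugj jmin} => [|j IH]; first by rewrite expr0 mulmx1.
    rewrite exprSr -mulmxE mulmxA.
    by apply: submx_trans (Ust g Gg); apply: submxMr.
  by apply/sub_kermxP; rewrite -mulmxA mulmxE -exprSr.
have capst h : G h -> stablemx (U :&: kermx g)%MS h.
  move=> Gh; rewrite sub_capmx; apply/andP; split.
    by apply: submx_trans (Ust h Gh); apply: submxMr; apply: capmxSl.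
  apply: submx_trans (comm_mx_stable_ker (Gcomm g h Gg Gh)).
  by apply: submxMr; apply: capmxSr.
have /rmin : exists2 U', good U' & \rank (U :&: kermx g)%MS = \rank U'.
  by exists (U :&: kermx g)%MS.
rewrite rE => rle; have := mxrank_leqif_sup (capmxSl U (kermx g)); case=> cle.
have -> : \rank (U :&: kermx g)%MS == \rank U by rewrite eqn_leq rle cle.
move=> /esym/submx_trans; apply; exact: capmxSr.
Qed.
End RowSpaces.

(** * Hamel bases and linear maps into polynomials *)

Lemma linear_bundle (K : fieldType) (V W : lmodType K) (f : V -> W) :
  linear f -> exists g : {linear V -> W}, g =1 f.
Proof.
move=> flin; pose g : {linear V -> W} := HB.pack f (GRing.isLinear.Build K V W *:%R f flin).
by exists g.
Qed.

Section HamelCoordinates.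
Variables (K : fieldType) (V : lmodType K).

Lemma sum_collect (W : lmodType K) (h : V -> W) (r : seq (K * V)) :
  \sum_(p <- r) p.1 *: h p.2 =
  \sum_(y <- undup (map snd r)) (\sum_(p <- r | p.2 == y) p.1) *: h y.
Proof.
under [RHS]eq_bigr do rewrite scaler_suml.
rewrite (exchange_big_dep xpredT) //= [LHS]big_seq [RHS]big_seq.
apply: eq_bigr => p pr; have p2 : p.2 \in undup (map snd r).
  by rewrite mem_undup map_f.
rewrite big_mkcond (bigD1_seq p.2) ?undup_uniq //= eqxx big1 ?addr0 //.
by move=> y; rewrite eq_sym => /negPf ->.
Qed.

(** The coordinates of a vector become the coefficients of a polynomial, a basis
    vector [b] being sent to the monomial of degree [h b].  Polynomials serve as
    the standard space of countable dimension, whose subspaces have echelon bases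
    by degree (see [echelon_basis]). *)
Lemma hamel_coordinates (B : set V) (h : V -> nat) :
    hamel_basis B -> {in B &, injective h} ->
  exists2 f : {linear V -> {poly K}}, injective f &
    forall x i, (f x)`_i != 0 -> exists2 b, B b & h b = i.
Proof.
move=> [Bfree Bspan] hinj.
pose mono y : {poly K} := 'X^(h y).
(* Formal combinations avoid choosing a support for each vector: [rel x p] says
   that one and the same combination of elements of B evaluates to x and p. *)
pose rel x p := exists r : seq (K * V), [/\ forall q, q \in r -> B q.2,
  x = \sum_(q <- r) q.1 *: q.2 & p = \sum_(q <- r) q.1 *: mono q.2].
have rel_lin a u v p q : rel u p -> rel v q -> rel (a *: u + v) (a *: p + q).
  move=> [r [rB -> ->]] [t [tB -> ->]].
  exists ([seq (a * w.1, w.2) | w <- r] ++ t); split.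
  - by move=> w; rewrite mem_cat => /orP[/mapP[z /rB ? ->]|/tB].
  - rewrite big_cat big_map scaler_sumr /=; congr (_ + _).
    by apply: eq_bigr => z _; rewrite scalerA.
  rewrite big_cat big_map scaler_sumr /=; congr (_ + _).
  by apply: eq_bigr => z _; rewrite scalerA.
have rel0 x p : rel x p -> (x == 0) = (p == 0).
  case=> r [rB -> ->]; pose u := undup (map snd r).
  pose c y := \sum_(q <- r | q.2 == y) q.1.
  rewrite (sum_collect mono r : _ = \sum_(y <- u) c y *: mono y).
  rewrite (sum_collect id r : _ = \sum_(y <- u) c y *: y).
  have uB y : y \in u -> B y.
    by rewrite mem_undup => /mapP[q qr ->]; apply: rB.
  apply/eqP/eqP => sum0; rewrite big_seq big1 // => y yu.
    by rewrite (Bfree u c (undup_uniq _) uB sum0) // scale0r.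
  have : (\sum_(z <- u) c z *: mono z)`_(h y) = 0 by rewrite sum0 coef0.
  rewrite coef_sum (bigD1_seq y) ?undup_uniq //= coefZ coefXn eqxx mulr1 big_seq_cond.
  rewrite big1 ?addr0 => [|z /andP[zu zy]]; first by move=> ->; rewrite scale0r.
  rewrite coefZ coefXn; case: eqP => [hyz|_]; last by rewrite mulr0.
  by case/eqP: zy; apply/esym/hinj => //; rewrite inE; apply: uB.
have [f fP] : {f : V -> {poly K} & forall x, rel x (f x)}.
  apply: choice => x; have /spanP[r [rB ->]] := Bspan x.
  by exists (\sum_(q <- r) q.1 *: mono q.2), r.
have rel_sub x y p q : rel x p -> rel y q -> rel (x - y) (p - q).
  by move=> xp yq; rewrite -scaleN1r -(scaleN1r q) addrC (addrC p); apply: rel_lin.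
have [|g gf] := @linear_bundle K V _ f.
  move=> a u v; apply/eqP; rewrite -subr_eq0.
  by rewrite -(rel0 _ _ (rel_sub _ _ _ _ (fP _) (rel_lin a _ _ _ _ (fP u) (fP v)))) subrr.
exists g => [x y|x i].
  rewrite !gf => fxy; apply/eqP; rewrite -subr_eq0.
  by rewrite (rel0 _ _ (rel_sub _ _ _ _ (fP x) (fP y))) fxy subrr.
rewrite gf; have [r [rB _ ->]] := fP x; rewrite coef_sum.
apply: contra_neqP => noB; rewrite big_seq big1 // => q qr.
rewrite coefZ coefXn; case: eqP => [iE|_]; last by rewrite mulr0.
by case: noB; exists q.2 => //; apply: rB.
Qed.

(** One vector for each degree that occurs in the image of [f]; independence
    comes from the distinct degrees, and generation from cancelling leading
    terms.  The set of degrees that occur indexes the basis. *)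
Lemma echelon_basis (f : {linear V -> {poly K}}) : injective f ->
  exists B : set V, [/\ hamel_basis B, countable B &
    forall n, (forall x, (size (f x) <= n)%N) -> finite_set B].
Proof.
move=> finj.
pose D : set nat := [set d | exists v, size (f v) = d.+1]%classic.
have [e eP] : {e : nat -> V & forall d, D d -> size (f (e d)) = d.+1}.
  apply: (choice (P := fun d v => D d -> size (f v) = d.+1)) => d.
  have [[v vd]|noD] := pselect (D d); first by exists v.
  by exists 0.
exists [set e d | d in D]%classic; split; last 2 first.
- exact: sub_countable (card_image_le e D) (countableP D).
- move=> n fn; apply: finite_image; apply: (sub_finite_set _ (finite_II n)) => d [v vd] /=.
  by rewrite -vd.
split=> [s c s_uniq sB sum0 y ys|x].
  apply/eqP/negPn/negP => cy.
  (* z is a vector of maximal degree among those with a nonzero coefficient. *)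
  have [|k [z zs [cz zk]] kmax] := @ex_least
      (fun k => exists2 z, z \in s & c z != 0 /\ k = (\max_(t <- s) size (f t) - size (f z))%N).
    by exists (\max_(t <- s) size (f t) - size (f y))%N, y.
  have top w : w \in s -> c w != 0 -> (size (f w) <= size (f z))%N.
    move=> ws cw; have := kmax _ (ex_intro2 _ _ w ws (conj cw erefl)).
    rewrite zk; have := @leq_bigmax_seq _ s xpredT (fun t => size (f t)) _ ws isT.
    have := @leq_bigmax_seq _ s xpredT (fun t => size (f t)) _ zs isT.
    move=> /=; lia.
  have [d dD ez] := sB z zs.
  have : (f (\sum_(t <- s) c t *: t))`_d = 0 by rewrite sum0 linear0 coef0.
  rewrite linear_sum coef_sum (bigD1_seq z) //= big_seq_cond big1 => [|w /andP[ws wz]].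
    rewrite addr0 linearZ coefZ => /eqP; rewrite mulf_eq0 (negPf cz) /=.
    by rewrite -ez -[d]/(d.+1.-1) -{2}(eP d dD) -lead_coefE lead_coef_eq0 -size_poly_eq0 eP.
  rewrite linearZ coefZ; have [->|cw] := eqVneq (c w) 0; first by rewrite mul0r.
  have [d' d'D ew] := sB w ws.
  rewrite nth_default ?mulr0 //; have := top w ws cw.
  rewrite -ew -ez !eP // ltnS leq_eqVlt => /predU1P[dd|//].
  by case/eqP: wz; rewrite -ew -ez dd.
have [n] := ubnP (size (f x)); elim: n x => // n IH x xn.
have [fx0|fx0] := eqVneq (f x) 0.
  by have -> : x = 0; [apply: finj; rewrite fx0 linear0 | exact: rpred0].
set d := (size (f x)).-1.
have dE : size (f x) = d.+1 by rewrite prednK // size_poly_gt0.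
have dD : D d by exists x.
pose a := lead_coef (f x) / lead_coef (f (e d)).
rewrite -(subrK (a *: e d) x); apply: rpredD; last first.
  by apply: rpredZ; apply: span_sub; exists d.
rewrite dE ltnS in xn.
apply: IH; rewrite linearB linearZ /=; apply: leq_trans xn; rewrite ltnS.
apply/leq_sizeP => j; rewrite leq_eqVlt => /predU1P[<-|dj].
  have -> : (f x - a *: f (e d))`_d = lead_coef (f x) - a * lead_coef (f (e d)).
    by rewrite coefB coefZ !lead_coefE eP // dE.
  rewrite divfK ?subrr //.
  by rewrite lead_coef_eq0 -size_poly_eq0 eP.
by rewrite coefB coefZ !nth_default ?mulr0 ?subrr ?eP ?dE.
Qed.

Lemma countable_dimP :
  countable_dim V <-> exists f : {linear V -> {poly K}}, injective f.
Proof.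
split=> [[B Bbasis /countable_injP[h hinj]]|[f finj]].
  by have [f] := hamel_coordinates Bbasis hinj; exists f.
by have [B [? ? _]] := echelon_basis finj; exists B.
Qed.

Lemma finite_dimP :
  finite_dim V <-> exists n (f : {linear V -> 'rV[K]_n}), injective f.
Proof.
split=> [[B Bbasis /finite_seqP[s Bs]]|[n [f finj]]].
  have [|f finj fsupp] := @hamel_coordinates B (index^~ s) Bbasis.
    move=> x y; rewrite Bs !inE /= => xs ys xy.
    by rewrite -(nth_index 0 xs) xy nth_index.
  exists (size s), (poly_rV \o f) => x y /= /(congr1 rVpoly).
  have fsize z : (size (f z) <= size s)%N.
    apply/leq_sizeP => j sj; apply/eqP; apply: contraTT sj => /fsupp[b].
    by rewrite Bs /= -index_mem => + <-; rewrite -ltnNge.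
  by rewrite !poly_rV_K // => /finj.
have [|B [Bbasis _ Bfin]] := @echelon_basis (rVpoly \o f).
  by apply: inj_comp finj; apply: can_inj rVpolyK.
by exists B => //; apply: (Bfin n) => x; apply: size_poly.
Qed.

End HamelCoordinates.

(** * Subspaces of finite codimension *)

Section FiniteCodimension.
Local Open Scope quotient_scope.
Variables (K : fieldType) (V : lmodType K).

Lemma finite_codimP (S : submodClosed V) :
  finite_dim (lmod_quot S) <->
  exists n (f : {linear V -> 'rV[K]_n}), forall x, (f x == 0) = (x \in S).
Proof.
have pi0 x : (\pi_(lmod_quot S) x == 0) = (x \in S).
  have -> : 0 = \pi_(lmod_quot S) 0 by rewrite !piE.
  by rewrite pi_quot_eq subr0.
have piP a x y : \pi_(lmod_quot S) (a *: x + y) =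
    a *: (\pi_(lmod_quot S) x : lmod_quot S) + \pi_(lmod_quot S) y.
  by rewrite pi_quot_add pi_quot_scale.
split=> [/finite_dimP[n [f finj]]|[n [f fS]]].
  have [|g gE] := @linear_bundle K V 'rV[K]_n (f \o \pi_(lmod_quot S)).
    by move=> a x y /=; rewrite piP linearP.
  exists n, g => x; rewrite gE /= -pi0 -[in RHS](inj_eq finj) linear0.
  by [].
apply/finite_dimP.
have fpi x : f (repr (\pi_(lmod_quot S) x)) = f x.
  by apply/eqP; rewrite -subr_eq0 -linearB fS -pi_quot_eq reprK.
have [|g gE] := @linear_bundle K (lmod_quot S) 'rV[K]_n (f \o repr).
  by move=> a x y /=; rewrite -linearP -{1}[x]reprK -{1}[y]reprK -piP fpi.
exists n, g => x y; rewrite !gE /= => /eqP; rewrite -subr_eq0 -linearB fS -pi_quot_eq.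
by rewrite !reprK => /eqP.
Qed.

Lemma image_row_space n (f : {linear V -> 'rV[K]_n}) (S : {pred V}) :
  submod_closed S ->
  exists U : 'M_n, forall v, (v <= U)%MS <-> exists2 x, x \in S & v = f x.
Proof.
move=> [S0 Slin]; pose P : {pred 'rV[K]_n} := fun v => `[< exists2 x, x \in S & v = f x >].
have [|U UP] := @submodule_row_space K n P.
  split=> [|a _ _ /asboolP[x xS ->] /asboolP[y yS ->]]; apply/asboolP.
    by exists 0; rewrite ?linear0.
  by exists (a *: x + y); rewrite ?linearP //; apply: Slin.
by exists U => v; rewrite UP; split=> [/asboolP|? ] //; apply/asboolP.
Qed.

(** Here the kernel of [f] may be smaller than [S]; composing [f] with the
    cokernel of the image of [S] enlarges it to exactly [S]. *)
Lemma finite_codim_sub n (f : {linear V -> 'rV[K]_n}) (S : submodClosed V) :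
  (forall x, f x = 0 -> x \in S) -> finite_dim (lmod_quot S).
Proof.
move=> fS; have [U UP] := image_row_space f (submodClosedP S).
apply/finite_codimP; exists n, (mulmxr (cokermx U) \o f) => x /=.
rewrite -submxE; apply/idP/idP => [/UP[y yS fxy]|xS]; last by apply/UP; exists x.
by rewrite -(subrK y x) rpredD // fS // linearB fxy subrr.
Qed.

Lemma linear_section n (f : {linear V -> 'rV[K]_n}) :
  (forall v, exists x, f x = v) -> exists s : {linear 'rV_n -> V}, cancel s f.
Proof.
move=> f_onto.
have [e eE] : {e : 'I_n -> V & forall i, f (e i) = delta_mx 0 i}.
  by apply: (choice (P := fun i x => f x = delta_mx 0 i)) => i; apply: f_onto.
have [|s sE] := @linear_bundle K 'rV[K]_n V (fun v => \sum_i v 0 i *: e i).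
  move=> a u v; rewrite scaler_sumr -big_split /=; apply: eq_bigr => i _.
  by rewrite !mxE scalerDl scalerA.
exists s => v; rewrite sE linear_sum [RHS]row_sum_delta; apply: eq_bigr => i _.
by rewrite linearZ /= eE.
Qed.

(** A map as in [finite_codimP] can be made onto by taking coordinates in its
    image. *)
Lemma finite_codim_onto (S : submodClosed V) : finite_dim (lmod_quot S) ->
  exists n (f : {linear V -> 'rV[K]_n}),
    (forall x, (f x == 0) = (x \in S)) /\ forall v, exists x, f x = v.
Proof.
move=> /finite_codimP[n [f fS]].
have [|U UP] := @image_row_space n f predT; first by [].
have fU x : (f x <= row_base U)%MS by rewrite eq_row_base; apply/UP; exists x.
exists (\rank U), (mulmxr (pinvmx (row_base U)) \o f); split=> [x|v] /=.
  rewrite -fS; apply/eqP/eqP => [fx|->]; last by rewrite mul0mx.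
  by rewrite -(mulmxKpV (fU x)) fx mul0mx.
have /UP[x _ vx] : (v *m row_base U <= U)%MS by rewrite -(eq_row_base U) submxMl.
by exists x; rewrite -vx mulmxKp ?row_base_free.
Qed.

End FiniteCodimension.

(** * Commutators that commute with a factor *)

Section Jacobson.
Variables (K : fieldType) (n : nat).
Implicit Types (p q : {poly K}) (a x : 'M[K]_n.+1).

(** Bracketing with [x] is a derivation, and [x a - a x] commutes with [a], so it
    acts on polynomials in [a] as the formal derivative does. *)
Lemma commutator_horner x a p : GRing.comm a (x * a - a * x) ->
  x * horner_mx a p - horner_mx a p * x = horner_mx a p^`() * (x * a - a * x).
Proof.
set c := x * a - a * x => cac.
elim/poly_ind: p => [|p k IH].
  by rewrite deriv0 !rmorph0 mulr0 !mul0r subrr.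
rewrite derivMXaddC !rmorphD !rmorphM /= horner_mx_X horner_mx_C.
set P := horner_mx a p in IH *; set P' := horner_mx a p^`() in IH *.
have -> : x * (P * a + k%:M) - (P * a + k%:M) * x = (x * P - P * x) * a + P * c.
  have kx : k%:M * x = x * k%:M by rewrite -mulmxE scalar_mxC.
  rewrite mulrDr mulrDl kx opprD addrACA subrr addr0.
  by rewrite /c mulrBl mulrBr !mulrA addrA subrK.
by rewrite IH -mulrA -cac mulrDl addrC !mulrA.
Qed.

(** Jacobson's lemma.  Start from an annihilating polynomial of [a], and
    differentiate: if q(a) c^j = 0, then multiplying q'(a) c = x q(a) - q(a) x by
    c^j on both sides gives q'(a) c^(2j+1) = 0.  In characteristic 0 the iterated
    derivatives end with a nonzero constant, which leaves a power of c. *)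
Lemma commutator_nilpotent x a : [pchar K] =i pred0 ->
  GRing.comm a (x * a - a * x) -> exists k, (x * a - a * x) ^+ k = 0.
Proof.
set c := x * a - a * x => char0 cac.
suff H d q j : size q = d.+1 -> horner_mx a q * c ^+ j = 0 ->
    exists k, c ^+ k = 0.
  apply: (H n.+1 (char_poly a) 0); first exact: size_char_poly.
  by rewrite Cayley_Hamilton mul0r.
elim: d q j => [|d IH] q j sq qc.
  move/eqP/size_poly1P: sq qc => [k k0 ->]; rewrite horner_mx_C.
  rewrite -mulmxE mul_scalar_mx => /eqP.
  by rewrite scaler_eq0 (negPf k0) => /eqP; exists j.
have sq' : size q^`() = d.+1.
  apply/eqP; rewrite eqn_leq; apply/andP; split.
    by rewrite -ltnS -sq lt_size_deriv // -size_poly_eq0 sq.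
  rewrite ltnNge; apply/negP => /leq_sizeP/(_ d (leqnn d))/eqP.
  rewrite coef_deriv -mulr_natr mulf_eq0 -[d.+1]/(d.+2.-1) -sq -lead_coefE.
  rewrite lead_coef_eq0 -size_poly_eq0 sq /=.
  by move=> /(natf0_pchar (ltn0Sn d))[r]; rewrite char0.
apply: (IH q^`() (j + 1 + j)%N sq').
have comm_cj (p : {poly K}) : c ^+ j * horner_mx a p = horner_mx a p * c ^+ j.
  symmetry; apply: commrX; apply: comm_horner_mx; exact: cac.
rewrite !exprD expr1 !mulrA -comm_cj -(mulrA (c ^+ j)) -commutator_horner //.
by rewrite mulrBr mulrBl -!mulrA qc !mulr0 sub0r !mulrA comm_cj qc !mul0r oppr0.
Qed.
End Jacobson.

(** * Brackets and derived series *)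

Lemma span_ind (K : fieldType) (V : lmodType K) (A : set V) (P : V -> Prop) :
    P 0 -> (forall c u v, P u -> P v -> P (c *: u + v)) -> (forall u, A u -> P u) ->
  forall v, v \in Defs.span A -> P v.
Proof.
move=> P0 Plin AP v /spanP[r [rA ->]].
elim: r rA => [|p r IH] rA; first by rewrite big_nil.
rewrite big_cons; apply: Plin; first by apply/AP/rA; rewrite mem_head.
by apply: IH => q qr; apply: rA; rewrite inE qr orbT.
Qed.

Section LieBasics.
Variables (K : fieldType) (L : lieAlgType K).
Implicit Types x y z : L.

Lemma lieDl x y z : lie (x + y) z = lie x z + lie y z.
Proof. by have := lie_linearl z 1 x y; rewrite !scale1r. Qed.

Lemma lieDr x y z : lie x (y + z) = lie x y + lie x z.
Proof. by have := lie_linearr x 1 y z; rewrite !scale1r. Qed.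

Lemma lieC x y : lie x y = - lie y x.
Proof.
apply/eqP; rewrite -addr_eq0; apply/eqP.
by have := lie_alt (x + y); rewrite lieDl !lieDr !lie_alt add0r addr0.
Qed.

Lemma lie0r x : lie x 0 = 0.
Proof. by apply: (addrI (lie x 0)); rewrite -lieDr !addr0. Qed.

Lemma lieNr x y : lie x (- y) = - lie x y.
Proof. by apply/eqP; rewrite -addr_eq0 -lieDr addNr lie0r. Qed.

Lemma lie_derivation x y z : lie x (lie y z) = lie (lie x y) z + lie y (lie x z).
Proof.
have := lie_jacobi x y z => /eqP; rewrite -addrA addr_eq0 => /eqP ->.
by rewrite (lieC z x) lieNr (lieC z (lie x y)) opprD !opprK addrC.
Qed.

Lemma derived_series_ideal i x y :
  y \in derived_series L i -> lie x y \in derived_series L i.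
Proof.
rewrite /derived_series; case: i => [|i] //=; elim: i x y => [//|i IH] x y.
move: y; apply: span_ind => [|c u v xu xv|_ [a [b [aD bD ->]]]].
- by rewrite lie0r rpred0.
- by rewrite lie_linearr; apply: rpredD => //; apply: rpredZ.
rewrite lie_derivation; apply: rpredD; apply: span_sub.
  by exists (lie x a), b; split=> //; apply: IH.
by exists a, (lie x b); split=> //; apply: IH.
Qed.

Lemma derived_series_anti i j : (i <= j)%N ->
  {subset derived_series L j <= derived_series L i}.
Proof.
move=> /subnKC <-; elim: (j - i)%N => [|k IH]; first by rewrite addn0.
rewrite addnS => x xD; apply: IH; move: xD.
case: (i + k)%N => [|m] //; move: x; apply: span_ind => [|c u v uD vD|_ [a [b [aD bD ->]]]].
- exact: rpred0.
- by apply: rpredD => //; apply: rpredZ.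
exact: derived_series_ideal.
Qed.

End LieBasics.

(** * Irreducible representations of solvable Lie algebras *)

(** Matrices act on row vectors, that is, on the right; the sign is the one
    for which the maps [lie^~ x] form a representation. *)
Definition lie_rep (K : fieldType) (L : lieAlgType K) n (rho : L -> 'M[K]_n) :=
  linear rho /\ forall x y, rho (lie x y) = rho x *m rho y - rho y *m rho x.

Section IrreducibleRep.
Variables (K : fieldType) (L : lieAlgType K) (n : nat) (rho : L -> 'M[K]_n.+1).
Hypotheses (char0 : [pchar K] =i pred0) (rho_rep : lie_rep rho).
Hypothesis rho_irr : forall U : 'M_n.+1,
  (forall x, stablemx U (rho x)) -> U != 0 -> row_full U.

Let rhoB x y : rho (lie x y) = rho x * rho y - rho y * rho x.
Proof. exact: rho_rep.2. Qed.

Let row_full_mul_eq0 (U : 'M[K]_n.+1) (A : 'M[K]_n.+1) :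
  row_full U -> U *m A = 0 -> A = 0.
Proof. by move=> /mulVpmx UU UA; rewrite -[A]mul1mx -UU -mulmxA UA mulmx0. Qed.

(* A bracket that is central in the image is nilpotent by Jacobson's lemma; its
   kernel is then nonzero, and invariant by centrality. *)
Let central_bracket_eq0 x y :
  (forall z, rho z * rho (lie x y) = rho (lie x y) * rho z) -> rho (lie x y) = 0.
Proof.
set c := rho _ => cC.
have [k ck] : exists k, c ^+ k = 0.
  by rewrite /c rhoB; apply: commutator_nilpotent => //; rewrite -rhoB; apply: cC.
have [||U U0 Uc] := @commuting_nilpotent_kernel K n (eq^~ c).
- by move=> g h -> ->.
- by move=> g ->; exists k.
have cker : kermx c != 0.
  apply: contraNneq U0 => c0; rewrite -submx0 -c0.
  by apply/sub_kermxP/Uc.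
apply: row_full_mul_eq0 (mulmx_ker c); apply: rho_irr => // z.
exact/comm_mx_stable_ker/esym/cC.
Qed.

(** With [A] the term of index [j.+2], the hypothesis says that the operators of
    [A] commute.  The brackets of [L] with [A] then have a common kernel, which is
    invariant because [A] is an ideal; so they vanish and [A] is central.  Being
    spanned by brackets, [A] acts as zero. *)
Lemma irreducible_derived_step j :
    (forall x, x \in derived_series L j.+3 -> rho x = 0) ->
  forall x, x \in derived_series L j.+2 -> rho x = 0.
Proof.
set A := derived_series L j.+2 => A'0.
have Acomm a b : a \in A -> b \in A -> rho a * rho b = rho b * rho a.
  move=> aA bA; apply/eqP; rewrite -subr_eq0 -rhoB; apply/eqP/A'0.
  by apply: span_sub; exists a, b.
have LA0 x a : a \in A -> rho (lie x a) = 0.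
  pose B (g : 'M[K]_n.+1) := exists x a, a \in A /\ g = rho (lie x a).
  have BA x' a' : a' \in A -> lie x' a' \in A by apply: derived_series_ideal.
  have [||U U0 UB] := @commuting_nilpotent_kernel K n B.
  - by move=> _ _ [u [a1 [a1A ->]]] [v [a2 [a2A ->]]]; apply: Acomm; apply: BA.
  - move=> _ [u [b [bA ->]]]; rewrite rhoB; apply: commutator_nilpotent => //.
    by rewrite -rhoB; apply: Acomm => //; apply: BA.
  (* W is the common kernel of all the brackets, U only a nonzero part of it. *)
  pose P : {pred 'rV[K]_n.+1} := fun v => `[< forall g, B g -> v *m g = 0 >].
  have [|W WP] := @submodule_row_space K n.+1 P.
    split=> [|c u v /asboolP uP /asboolP vP]; apply/asboolP => g Bg.
      by rewrite mul0mx.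
    by rewrite mulmxDl -scalemxAl uP // vP // scaler0 addr0.
  move=> aA; apply: (@row_full_mul_eq0 W); last first.
    apply/row_matrixP => i; rewrite row_mul row0.
    have /asboolP/(_ _ (ex_intro _ x (ex_intro _ a (conj aA erefl)))) // : row i W \in P.
    by rewrite -WP row_sub.
  apply: rho_irr => [z|].
    apply/row_subP => i; rewrite row_mul WP; apply/asboolP => _ [y [b [bA ->]]].
    have /asboolP WiP : row i W \in P by rewrite -WP row_sub.
    have -> : row i W *m rho z *m rho (lie y b) =
        row i W *m rho (lie y b) *m rho z + row i W *m rho (lie z (lie y b)).
      by rewrite (rhoB z) mulmxBr -!mulmxE !mulmxA addrC subrK.
    rewrite WiP ?mul0mx ?add0r; last by exists y, b.
    by apply: WiP; exists z, (lie y b); split=> //; apply: BA.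
  apply: contraNneq U0 => W0; rewrite -submx0 -W0; apply/row_subP => i.
  rewrite WP; apply/asboolP => g Bg.
  by rewrite -row_mul UB // row0.
apply: span_ind => [|c u v u0 v0|_ [x [y [xD yD ->]]]].
- by have := rho_rep.1 (-1) 0 0; rewrite scaler0 addr0 scaleN1r addNr.
- by rewrite (rho_rep.1 c u v) u0 v0 scaler0 addr0.
apply: central_bracket_eq0 => z; apply/eqP; rewrite -subr_eq0 -rhoB LA0 //.
by apply: span_sub; exists x, y.
Qed.

Lemma irreducible_derived_eq0 k :
    (forall x, x \in derived_series L k.+2 -> rho x = 0) ->
  forall x, x \in derived_series L 2 -> rho x = 0.
Proof. by elim: k => [//|k IH] rho0; apply/IH/irreducible_derived_step. Qed.

End IrreducibleRep.

(** * Nilpotency of the derived algebra of a solvable Lie algebra *)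

Section Representations.
Variables (K : fieldType) (L : lieAlgType K).

Lemma intertwine_prod m n (S : 'M[K]_(m, n)) (sigma : L -> 'M_m) (rho : L -> 'M_n) :
    (forall x, S *m rho x = sigma x *m S) ->
  forall s, S *m (\prod_(x <- s) rho x) = (\prod_(x <- s) sigma x) *m S.
Proof.
move=> Srho; elim=> [|x s IH]; first by rewrite !big_nil mulmx1 mul1mx.
by rewrite !big_cons -!mulmxE mulmxA Srho -mulmxA IH mulmxA.
Qed.

(** When [V] is row free, this is the restriction of [rho] to the row space of
    [V], written in the basis [V]. *)
Lemma lie_rep_conj m n (V : 'M[K]_(m, n)) (rho : L -> 'M_n) :
  lie_rep rho -> (forall x, stablemx V (rho x)) -> lie_rep (conjmx V \o rho).
Proof.
move=> [rho_lin rho_lie] Vst; split=> [c x y|x y] /=.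
  by rewrite rho_lin /conjmx mulmxDr mulmxDl -scalemxAr -scalemxAl.
rewrite -!conjmxM ?inE // rho_lie.
by rewrite /conjmx mulmxBr mulmxBl.
Qed.

Lemma lie_rep_dual n (rho : L -> 'M[K]_n) :
  lie_rep rho -> lie_rep (fun x => - (rho x)^T).
Proof.
move=> [rho_lin rho_lie]; split=> [c x y|x y].
  by rewrite rho_lin linearP opprD scalerN.
by rewrite rho_lie linearB /= !trmx_mul !mulNmx !mulmxN !opprK opprB.
Qed.

Definition nilpotent_action n (rho : L -> 'M[K]_n) :=
  exists i, forall s, size s = i -> {subset s <= derived_series L 2} ->
    \prod_(x <- s) rho x = 0.

(** The row space of [V] carries the action [sigma], and [Y] is a projection to
    [tau] with kernel inside that row space: enough factors vanish on [tau], hence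
    send everything into [V], and enough further ones kill [V]. *)
Lemma nilpotent_action_ext n m (V : 'M[K]_(m, n)) p (Y : 'M_(n, p))
    (rho : L -> 'M_n) (sigma : L -> 'M_m) (tau : L -> 'M_p) :
    (kermx Y <= V)%MS ->
    (forall x, V *m rho x = sigma x *m V) -> (forall x, Y *m tau x = rho x *m Y) ->
  nilpotent_action sigma -> nilpotent_action tau -> nilpotent_action rho.
Proof.
move=> YV Vrho Ytau [i sigma0] [j tau0]; exists (j + i)%N => s ss sD.
rewrite -(cat_take_drop j s) big_cat /=.
set P := \prod_(x <- take j s) rho x.
have PV : (P <= V)%MS.
  apply: submx_trans YV; apply/sub_kermxP.
  rewrite -(intertwine_prod Ytau) tau0 ?mulmx0 //.
    by rewrite size_takel // ss leq_addr.
  by move=> x /mem_take/sD.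
have /submxP[X ->] := PV.
rewrite -mulmxE -mulmxA (intertwine_prod Vrho) sigma0 ?mul0mx ?mulmx0 //.
  by rewrite size_drop ss addKn.
by move=> x /mem_drop/sD.
Qed.

Theorem solvable_nilpotent_action k : [pchar K] =i pred0 ->
  forall n (rho : L -> 'M[K]_n), lie_rep rho ->
    (forall x, x \in derived_series L k.+2 -> rho x = 0) -> nilpotent_action rho.
Proof.
move=> char0 n; have [m] := ubnP n; elim: m n => // m IH [|n] nm rho rho_rep rho0.
  by exists 0%N => s _ _; apply: flatmx0.
have [irr|] := pselect (forall U : 'M_n.+1,
    (forall x, stablemx U (rho x)) -> U != 0 -> row_full U).
  exists 1%N => -[|x []] // _ sD; rewrite big_seq1.
  by apply: (irreducible_derived_eq0 char0 rho_rep irr rho0); apply: sD; rewrite mem_head.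
move=> /existsNP[W] /not_implyP[Wst] /not_implyP[W0 Wfull].
have rW0 : (0 < \rank W)%N by rewrite lt0n mxrank_eq0.
have rWn : (\rank W < n.+1)%N.
  by rewrite ltn_neqAle rank_leq_row andbT; apply/negP.
(* The quotient by W is obtained as the dual of the restriction of the dual
   representation to the annihilator of W, the row space of Y. *)
pose V := row_base W; pose Y := row_base (kermx W^T).
have Vst x : stablemx V (rho x) by rewrite stablemx_row_base.
have Yst x : stablemx Y (- (rho x)^T).
  rewrite stablemx_row_base; apply/sub_kermxP.
  have /submxP[X WX] := Wst x.
  by rewrite mulmxN mulNmx -mulmxA -trmx_mul WX trmx_mul mulmxA mulmx_ker mul0mx oppr0.
pose tau x := - (conjmx Y (- (rho x)^T))^T.
apply: (@nilpotent_action_ext n.+1 _ V _ Y^T rho (conjmx V \o rho) tau).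
- have WY : (W <= kermx Y^T)%MS.
    apply/sub_kermxP/trmx_inj; rewrite trmx_mul trmxK trmx0.
    by apply/sub_kermxP; rewrite eq_row_base.
  have rY : \rank Y = (n.+1 - \rank W)%N.
    by rewrite eq_row_base mxrank_ker mxrank_tr.
  have := mxrank_leqif_sup WY; case=> _.
  rewrite mxrank_ker mxrank_tr rY subKn 1?ltnW // eqxx => /esym KW.
  by rewrite eq_row_base.
- by move=> x; rewrite /= /conjmx mulmxKpV.
- move=> x; have YK := mulmxKpV (Yst x).
  apply: trmx_inj; rewrite !trmx_mul !trmxK /tau raddfN /= trmxK mulNmx /conjmx YK.
  by rewrite mulmxN opprK.
- apply: IH => [||x xD /=].
  + exact: leq_trans rWn _.
  + exact: lie_rep_conj.
  by rewrite rho0 // /conjmx mulmx0 mul0mx.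
apply: IH => [||x xD].
+ rewrite mxrank_ker mxrank_tr; move: nm rW0; lia.
+ exact/lie_rep_dual/lie_rep_conj/Yst/lie_rep_dual.
by rewrite /tau rho0 // /conjmx trmx0 oppr0 mulmx0 mul0mx trmx0 oppr0.
Qed.

End Representations.

(** * The derived algebra of a pro-solvable Lie algebra *)

Section DerivedAlgebra.
Variables (K : fieldType) (L : lieAlgType K).
Notation N := (sub_lie (derived_series L 2)).
Notation D := (derived_series L).

(** The inclusion of [N] in [L], as a function that carries its own linear
    structure. *)
Definition derived_val (x : N) : L := sub_lie_val x.

Lemma derived_val_linear : linear derived_val.
Proof. by []. Qed.

HB.instance Definition _ :=
  GRing.isLinear.Build K N L *:%R derived_val derived_val_linear.

Lemma derived_val_inj : injective derived_val.
Proof. exact: val_inj. Qed.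

(** The bracket of [D k] with itself lies in its bracket with [N] as soon as [D k]
    lies in [N]. *)
Lemma derived_lower_central j (x : N) :
  derived_val x \in D j.+2 -> x \in lower_central N j.+1.
Proof.
elim: j x => [//|j IH] [x xN] /= xD.
suff H y : y \in D j.+3 -> exists2 z : N, derived_val z = y & z \in lower_central N j.+2.
  by have [z zx zN] := H x xD; have -> : SubLie xN = z by apply: val_inj.
move: y {x xN xD}; apply: span_ind => [|c _ _ [u <- uN] [v <- vN]|_ [a [b [aD bD ->]]]].
- by exists 0; rewrite ?linear0 ?rpred0.
- by exists (c *: u + v); rewrite ?linearP // rpredD // rpredZ.
have D2 y : y \in D j.+2 -> y \in D 2 by apply: derived_series_anti.
exists (lie (SubLie (D2 a aD) : N) (SubLie (D2 b bD))) => //.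
by apply: span_sub; exists (SubLie (D2 a aD)), (SubLie (D2 b bD)); split=> //; apply: IH.
Qed.

(** The right adjoint representation on the quotient of [L] by the ideal [S],
    identified with row vectors through [f].  Its matrices are computed on the
    lifts of the standard basis given by a linear section of [f]. *)
Lemma quotient_adjoint_rep (S : submodClosed L) n (f : {linear L -> 'rV[K]_n}) :
    (forall x y, y \in S -> lie x y \in S) -> (forall x, (f x == 0) = (x \in S)) ->
    (forall v, exists x, f x = v) ->
  exists2 rho : L -> 'M_n, lie_rep rho &
    (forall x, x \in S -> rho x = 0) /\ forall x y, f (lie x y) = f x *m rho y.
Proof.
move=> S_ideal fS f_onto.
have [s sK] := linear_section f_onto.
(* Right multiplication only depends on classes modulo the ideal S. *)
have f_bracket x z : f (lie (s (f x)) z) = f (lie x z).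
  apply/eqP; rewrite -subr_eq0 -linearB fS.
  have -> : lie (s (f x)) z - lie x z = lie z (x - s (f x)).
    by rewrite lieDr lieNr !(lieC z) opprK addrC.
  by rewrite S_ideal // -fS linearB sK subrr.
pose rho y := lin1_mx (fun v => f (lie (s v) y)).
have f_rho x y : f (lie x y) = f x *m rho y.
  have [|g gE] := @linear_bundle K 'rV[K]_n 'rV[K]_n (fun v => f (lie (s v) y)).
    by move=> c u v; rewrite linearP lie_linearl linearP.
  rewrite -f_bracket -(gE (f x)) -mul_rV_lin1; congr (_ *m _).
  by apply/matrixP => i j; rewrite !mxE gE.
have rhoE y i : row i (rho y) = f (lie (s (delta_mx 0 i)) y).
  by rewrite f_rho sK rowE.
exists rho.
  split=> [c x y|x y]; apply/row_matrixP => i.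
    by rewrite linearP /= !rhoE -linearP lie_linearr.
  rewrite linearB /= !row_mul !rhoE -!f_rho -linearB; congr (f _).
  by rewrite lie_derivation (lieC x (lie _ y)).
split=> // x xS; apply/row_matrixP => i; rewrite rhoE row0; apply/eqP.
by rewrite fS S_ideal.
Qed.

(** A [j]-fold bracket acts on [L / D k.+2] through a product of [j] operators
    coming from [N], and long products of those vanish. *)
Lemma lower_central_derived k : [pchar K] =i pred0 ->
    finite_dim (lmod_quot (D k.+2)) ->
  exists i, forall x : N, x \in lower_central N i.+1 -> derived_val x \in D k.+2.
Proof.
move=> char0 /finite_codim_onto[n [f [fS f_onto]]].
have [rho rho_rep [rho0 f_rho]] :=
  quotient_adjoint_rep (@derived_series_ideal K L k.+2) fS f_onto.
have [i rho_nil] := solvable_nilpotent_action char0 rho_rep rho0.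
exists i.
(* Brackets peeled off from x are transferred to the list s. *)
suff H j (x : N) s : x \in lower_central N j.+1 -> (j + size s = i)%N ->
    {subset s <= D 2} -> f (derived_val x) *m \prod_(y <- s) rho y = 0.
  move=> x xN; rewrite -fS; have := H i x [::] xN (addn0 i).
  by rewrite big_nil mulmx1 => ->.
elim: j x s => [|j IH] x s; first by move=> _ si sD; rewrite rho_nil ?mulmx0.
move=> + ij sD; move: x; apply: span_ind => [|c u v u0 v0|_ [u [v [uN _ ->]]]].
- by rewrite !linear0 mul0mx.
- by rewrite !linearP mulmxDl -scalemxAl u0 v0 scaler0 addr0.
rewrite -[derived_val _]/(lie (derived_val u) (derived_val v)) f_rho -mulmxA.
have := IH u (derived_val v :: s) uN; rewrite big_cons -mulmxE; apply.
  by rewrite addnS.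
by move=> y; rewrite inE => /predU1P[->|/sD //]; apply: sub_lie_valP.
Qed.

(** A linear section of the projection onto [L / N] splits [L] as the direct sum
    of that quotient and [N]. *)
Lemma derived_finite_dim :
  finite_dim (lmod_quot (D 2)) -> finite_dim N -> finite_dim L.
Proof.
move=> /finite_codim_onto[n [f [fS f_onto]]] /finite_dimP[m [g ginj]].
apply/finite_dimP.
have [s sK] := linear_section f_onto.
have tN x : x - s (f x) \in D 2 by rewrite -fS linearB sK subrr.
have [|h hE] := @linear_bundle K L 'rV_(n + m)
    (fun x => row_mx (f x) (g (SubLie (tN x)))).
  move=> c x y; rewrite scale_row_mx add_row_mx; congr row_mx.
    exact: linearP.
  rewrite -linearP; congr (g _); apply: derived_val_inj.
  rewrite [RHS]linearP /derived_val /=.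
  have -> : s (f (c *: x + y)) = c *: s (f x) + s (f y) by rewrite !linearP.
  by rewrite scalerBr opprD addrACA.
exists (n + m)%N, h => x y; rewrite !hE => /eq_row_mx[fxy /ginj/(congr1 derived_val)].
by rewrite /derived_val /= fxy => /addIr.
Qed.

Theorem derived_pro_nilpotent : [pchar K] =i pred0 ->
  pro_solvable L -> pro_nilpotent N.
Proof.
move=> char0 [L_infinite L_sep L_codim]; split.
- by move=> /(derived_finite_dim (L_codim 1%N isT)).
- move=> x xN; apply: derived_val_inj; rewrite linear0; apply: L_sep => -[|[|k]] // _.
  have [i iP] := lower_central_derived char0 (L_codim k.+1 isT).
  by apply/iP/xN.
move=> [//|i] _; have /finite_codimP[n [f fS]] := L_codim i.+2 isT.
apply: (@finite_codim_sub K N n (f \o derived_val)) => x /= /eqP.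
by rewrite fS => /derived_lower_central.
Qed.

Lemma sub_countable_dim : countable_dim L -> countable_dim N.
Proof.
move=> /countable_dimP[f finj]; apply/countable_dimP.
by exists (f \o derived_val); apply: inj_comp finj derived_val_inj.
Qed.

End DerivedAlgebra.

Theorem proposition2p7 (R : realType) (L : lieAlgType R[i])
  (L_countable : countable_dim L) (L_prosolv : pro_solvable L) :
  countable_dim (sub_lie (derived_series L 2)) /\
  pro_nilpotent (sub_lie (derived_series L 2)).
Proof.
split; first exact: sub_countable_dim.
exact: derived_pro_nilpotent (Num.Theory.pchar_num _) L_prosolv.
Qed.
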